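(* Consider the planar quadratic system with real coefficients $$\dot x=a_1x+a_2y+a_3x^2+a_4y^2+a_5xy,\qquad \dot y=b_1x+b_2y+b_3x^2+b_4y^2+b_5xy.$$ Consider the two equations $$(Q)\quad a_2m^2+(a_1-b_2)m-b_1=0,\qquad (C)\quad a_4m^3+(a_5-b_4)m^2+(a_3-b_5)m-b_3=0.$$ (1) The line $y=mx$ is invariant under the flow of the system if and only if one of the following holds: (a) $a_2=0$, $b_1=0$ and $a_1=b_2$; in this case the real values of $m$ obtained from the cubic equation $(C)$ give the invariant lines $y=mx$; (b) $a_4=0$, $b_3=0$, $a_5=b_4$, $a_3=b_5$ and $(b_2-a_1)^2+4b_1a_2\ge 0$; in this case the real values of $m$ obtained from the quadratic equation $b_1+(b_2-a_1)m-a_2m^2=0$ give the invariant lines; (c) the coefficients in equations $(Q)$ and $(C)$ are not all zero; in this case the real values of $m$ satisfying $(Q)$ and $(C)$ simultaneously give the invariant lines $y=mx$; (d) the coefficients in $(Q)$ and $(C)$ are all zero; in this case there exist infinitely many invariant straight lines, namely $y=mx$ for all $m\in\mathbb{R}$. (2) Let $k,l$ be real constants. The line $x=k$ (respectively, $y=l$) is invariant under the flow of the system if $a_1k+a_2y+a_3k^2+a_4y^2+a_5ky=0$ for all $y\in\mathbb{R}$ (respectively, $b_1x+b_2l+b_3x^2+b_4l^2+b_5xl=0$ for all $x\in\mathbb{R}$).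
   Context: A set $S\subseteq\mathbb{R}^2$ is invariant under the flow $\Phi_t$ of a planar system if $\Phi_t(X_0)\in S$ for every $X_0\in S$ and every $t$ in the maximal interval of existence $I(X_0)$ of the solution with initial value $X_0$. *)

(* Defs.v *)
From Stdlib Require Import Reals Ensembles ClassicalEpsilon.
From Coquelicot Require Import Coquelicot.
Open Scope R_scope.

Definition quadratic_field (a1 a2 a3 a4 a5 b1 b2 b3 b4 b5 : R) (p : R * R) : R * R :=
  let (x, y) := p in
  (a1 * x + a2 * y + a3 * x ^ 2 + a4 * y ^ 2 + a5 * x * y,
   b1 * x + b2 * y + b3 * x ^ 2 + b4 * y ^ 2 + b5 * x * y).

Definition in_interval (alpha beta : Rbar) (t : R) : Prop :=
  Rbar_lt alpha t /\ Rbar_lt t beta.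

(* [phi] solves X' = V(X), X(0) = X0 on the open interval (alpha, beta), which
   contains 0 and may be unbounded; values of [phi] elsewhere are irrelevant. *)
Definition is_solution (V : R * R -> R * R) (X0 : R * R)
    (alpha beta : Rbar) (phi : R -> R * R) : Prop :=
  in_interval alpha beta 0 /\
  phi 0 = X0 /\
  forall t, in_interval alpha beta t ->
    is_derive (fun s => fst (phi s)) t (fst (V (phi t))) /\
    is_derive (fun s => snd (phi s)) t (snd (V (phi t))).

(* [p] is the value at time [t] of some solution starting at [X0]. *)
Definition reaches (V : R * R -> R * R) (X0 : R * R) (t : R) (p : R * R) : Prop :=
  exists (alpha beta : Rbar) (phi : R -> R * R),
    is_solution V X0 alpha beta phi /\ in_interval alpha beta t /\ phi t = p.

(* For locally Lipschitz [V] (in particular polynomial [V]), solutions agree on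
   common domains, so the maximal interval of existence is the union of the
   domains of all solutions, and the maximal solution takes at [t] the value of
   any solution defined at [t]. *)
Definition maximal_interval (V : R * R -> R * R) (X0 : R * R) : Ensemble R :=
  fun t => exists p, reaches V X0 t p.

(* Meaningful only for [t] in [maximal_interval V X0]. *)
Definition flow (V : R * R -> R * R) (t : R) (X0 : R * R) : R * R :=
  epsilon (inhabits X0) (reaches V X0 t).

Definition invariant (V : R * R -> R * R) (S : Ensemble (R * R)) : Prop :=
  forall X0, In _ S X0 ->
  forall t, In _ (maximal_interval V X0) t -> In _ S (flow V t X0).

Definition line_through_origin (m : R) : Ensemble (R * R) :=
  fun p => snd p = m * fst p.

Definition vertical_line (k : R) : Ensemble (R * R) := fun p => fst p = k.

Definition horizontal_line (l : R) : Ensemble (R * R) := fun p => snd p = l.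

(* Main.v *)
(* Along y = m x the transversal velocity y' - m x' equals -(x Q(m) + x^2 C(m)).
   If Q(m) = C(m) = 0, then w = y - m x satisfies a linear equation w' = A(t) w
   along every solution, so w stays 0 by Gronwall; the lines x = k and y = l are
   treated in the same way. Conversely, a local solution through (x, m x), built
   as a power series whose coefficients grow at most geometrically, agrees with
   the flow by uniqueness, hence stays on the line, and its velocity at time 0
   is tangent to it; x = 1 and x = -1 then give Q(m) = C(m) = 0. *)

Require Import Defs.
From Stdlib Require Import ClassicalEpsilon List FinFun Lra Lia.
From Stdlib Require Import Reals Ensembles Finite_sets.
From Coquelicot Require Import Coquelicot.
Open Scope R_scope.

(** * Gronwall estimate and linear systems with zero initial data *)

Lemma segment_abs_bound (f : R -> R) (t : R) :
  (forall s, Rmin 0 t <= s <= Rmax 0 t -> continuous f s) ->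
  exists M, 0 <= M /\ forall s, Rmin 0 t <= s <= Rmax 0 t -> Rabs (f s) <= M.
Proof.
  intros Hf.
  assert (Hle : Rmin 0 t <= Rmax 0 t) by apply Rminmax.
  destruct (continuity_ab_maj (fun s => Rabs (f s)) _ _ Hle) as [c [Hc _]].
  { intros s Hs.
    apply (continuity_pt_comp f Rabs).
    - apply continuity_pt_filterlim, Hf, Hs.
    - apply Rcontinuity_abs. }
  exists (Rabs (f c)); split; [apply Rabs_pos | exact Hc].
Qed.

(** Damping [u] by an exponential of rate [K] makes it nonincreasing as [s] moves from 0 towards
    [t]. The damped function starts at 0 and is nonnegative, so it is still 0 at [t]. *)
Lemma gronwall_zero (u du : R -> R) (K t : R) :
  (forall s, Rmin 0 t <= s <= Rmax 0 t ->
     0 <= u s /\ is_derive u s (du s) /\ Rabs (du s) <= K * u s) ->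
  u 0 = 0 -> u t = 0.
Proof.
  intros Hu H0.
  (* [sigma], the sign of [t], treats both time directions at once. *)
  assert (Hsigma : exists sigma, sigma * t = Rabs t).
  { destruct (Rle_or_lt 0 t).
    - exists 1; rewrite Rabs_pos_eq; lra.
    - exists (-1); rewrite Rabs_left; lra. }
  destruct Hsigma as [sigma Hsigma].
  assert (Hd : forall s, Rmin 0 t <= s <= Rmax 0 t ->
    is_derive (fun s => u s * exp (- (sigma * K * s))) s
      ((du s - sigma * K * u s) * exp (- (sigma * K * s)))).
  { intros s Hs; destruct (Hu s Hs) as [_ [Hder _]].
    auto_derive; [now exists (du s) |].
    replace (Derive (fun x => u x) s) with (du s)
      by (symmetry; now apply is_derive_unique).
    ring. }
  destruct (MVT_gen (fun s => u s * exp (- (sigma * K * s))) 0 t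
    (fun s => (du s - sigma * K * u s) * exp (- (sigma * K * s))))
    as [c [Hc Heq]].
  - intros s Hs; apply Hd; lra.
  - intros s Hs; apply derivable_continuous_pt.
    eexists; apply is_derive_Reals, Hd, Hs.
  - destruct (Hu c Hc) as [_ [_ Hb]].
    assert (Ht : Rmin 0 t <= t <= Rmax 0 t)
      by (split; [apply Rmin_r | apply Rmax_r]).
    destruct (Hu t Ht) as [Hpos _].
    rewrite H0, Rmult_0_l, !Rminus_0_r in Heq.
    (* The increment of the damped function given by the mean value theorem is at most 0, since
       [du c * t <= K * u c * Rabs t] and [Rabs t = sigma * t]. *)
    assert (Hnum : (du c - sigma * K * u c) * t <= 0).
    { assert (du c * t <= K * u c * Rabs t).
      { eapply Rle_trans; [apply Rle_abs |].
        rewrite Rabs_mult.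
        apply Rmult_le_compat_r; [apply Rabs_pos | exact Hb]. }
      rewrite <- Hsigma in H. nra. }
    pose proof (exp_pos (- (sigma * K * c))).
    pose proof (exp_pos (- (sigma * K * t))).
    nra.
Qed.

(** Gronwall applied to the squared norm [u ^ 2 + v ^ 2]. The rate comes from bounds of the four
    coefficients on the compact segment between 0 and [t]. *)
Lemma linear_system_zero (A B C D u v : R -> R) (t : R) :
  (forall s, Rmin 0 t <= s <= Rmax 0 t ->
     continuous A s /\ continuous B s /\ continuous C s /\ continuous D s) ->
  (forall s, Rmin 0 t <= s <= Rmax 0 t ->
     is_derive u s (A s * u s + B s * v s) /\
     is_derive v s (C s * u s + D s * v s)) ->
  u 0 = 0 -> v 0 = 0 -> u t = 0 /\ v t = 0.
Proof.
  intros Hc Hd Hu0 Hv0.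
  destruct (segment_abs_bound A t) as [MA [HA0 HA]]; [intros; now apply Hc |].
  destruct (segment_abs_bound B t) as [MB [HB0 HB]]; [intros; now apply Hc |].
  destruct (segment_abs_bound C t) as [MC [HC0 HC]]; [intros; now apply Hc |].
  destruct (segment_abs_bound D t) as [MD [HD0 HD]]; [intros; now apply Hc |].
  assert (H : u t ^ 2 + v t ^ 2 = 0).
  { apply (gronwall_zero (fun s => u s ^ 2 + v s ^ 2)
      (fun s => 2 * u s * (A s * u s + B s * v s)
              + 2 * v s * (C s * u s + D s * v s))
      (2 * (MA + MB + MC + MD)) t).
    - intros s Hs; destruct (Hd s Hs) as [Hu Hv]; split; [| split].
      + nra.
      + auto_derive; [split; [eexists; exact Hu | split; [eexists; exact Hv | easy]] |].
        replace (Derive (fun x => u x) s) with (A s * u s + B s * v s)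
          by (symmetry; now apply is_derive_unique).
        replace (Derive (fun x => v x) s) with (C s * u s + D s * v s)
          by (symmetry; now apply is_derive_unique).
        ring.
      + specialize (HA s Hs); specialize (HB s Hs).
        specialize (HC s Hs); specialize (HD s Hs).
        apply Rabs_le_between in HA, HB, HC, HD.
        (* The cross terms are absorbed through [2 |u v| <= u ^ 2 + v ^ 2]. *)
        assert (Hsum : forall c M, - M <= c <= M -> 0 <= M ->
          - (M * (u s ^ 2 + v s ^ 2)) <= c * (2 * u s * v s)
            <= M * (u s ^ 2 + v s ^ 2)).
        { intros c M Hcm HM. apply Rabs_le_between. rewrite Rabs_mult.
          apply Rmult_le_compat; try apply Rabs_pos.
          - now apply Rabs_le_between.
          - pose proof (pow2_ge_0 (u s + v s)); pose proof (pow2_ge_0 (u s - v s)).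
            apply Rabs_le_between; split; lra. }
        pose proof (Hsum _ _ HB HB0). pose proof (Hsum _ _ HC HC0).
        pose proof (pow2_ge_0 (u s)). pose proof (pow2_ge_0 (v s)).
        apply Rabs_le_between; split; nra.
    - rewrite Hu0, Hv0; ring. }
  split; nra.
Qed.

(** * Uniqueness of solutions *)

Lemma in_interval_segment (alpha beta : Rbar) (t s : R) :
  in_interval alpha beta 0 -> in_interval alpha beta t ->
  Rmin 0 t <= s <= Rmax 0 t -> in_interval alpha beta s.
Proof.
  intros [Ha0 Hb0] [Hat Hbt] [Hs1 Hs2].
  split.
  - apply Rbar_lt_le_trans with (Rmin 0 t); [| exact Hs1].
    unfold Rmin; now destruct Rle_dec.
  - apply Rbar_le_lt_trans with (Rmax 0 t); [exact Hs2 |].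
    unfold Rmax; now destruct Rle_dec.
Qed.

Lemma flow_reaches (V : R * R -> R * R) (X0 : R * R) (t : R) :
  In _ (maximal_interval V X0) t -> reaches V X0 t (flow V t X0).
Proof. intros H; exact (epsilon_spec (inhabits X0) (reaches V X0 t) H). Qed.

(** The difference of two solutions with the same initial value solves a linear system whose
    coefficients depend continuously on time along both solutions, so it vanishes. This makes the
    value chosen by [flow] independent of the solution that witnesses it. *)
Lemma quadratic_reaches_unique (a1 a2 a3 a4 a5 b1 b2 b3 b4 b5 t : R)
    (X0 p q : R * R) :
  let V := quadratic_field a1 a2 a3 a4 a5 b1 b2 b3 b4 b5 in
  reaches V X0 t p -> reaches V X0 t q -> p = q.
Proof.
  intros V [al [be [phi [[H0 [Hi Hphi]] [Ht Hp]]]]]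
    [al' [be' [psi [[H0' [Hi' Hpsi]] [Ht' Hq]]]]].
  unfold V, quadratic_field in Hphi, Hpsi.
  pose (x := fun s => fst (phi s)); pose (y := fun s => snd (phi s)).
  pose (x' := fun s => fst (psi s)); pose (y' := fun s => snd (psi s)).
  assert (HD : forall s, Rmin 0 t <= s <= Rmax 0 t ->
    (is_derive x s (a1 * x s + a2 * y s + a3 * x s ^ 2 + a4 * y s ^ 2 + a5 * x s * y s) /\
     is_derive y s (b1 * x s + b2 * y s + b3 * x s ^ 2 + b4 * y s ^ 2 + b5 * x s * y s)) /\
    (is_derive x' s (a1 * x' s + a2 * y' s + a3 * x' s ^ 2 + a4 * y' s ^ 2 + a5 * x' s * y' s) /\
     is_derive y' s (b1 * x' s + b2 * y' s + b3 * x' s ^ 2 + b4 * y' s ^ 2 + b5 * x' s * y' s))).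
  { intros s Hs; split.
    - specialize (Hphi s (in_interval_segment _ _ _ _ H0 Ht Hs)).
      unfold x, y; destruct (phi s); exact Hphi.
    - specialize (Hpsi s (in_interval_segment _ _ _ _ H0' Ht' Hs)).
      unfold x', y'; destruct (psi s); exact Hpsi. }
  assert (Hx0 : x 0 = x' 0) by (unfold x, x'; congruence).
  assert (Hy0 : y 0 = y' 0) by (unfold y, y'; congruence).
  assert (Hgoal : x t = x' t /\ y t = y' t -> p = q).
  { rewrite <- Hp, <- Hq. unfold x, x', y, y'.
    destruct (phi t), (psi t); simpl; intros [-> ->]; reflexivity. }
  apply Hgoal; clear Hgoal Hphi Hpsi.
  clearbody x y x' y'.
  (* The coefficients come from [x^2 - x'^2 = (x + x') (x - x')], likewise for [y], and
     [x y - x' y' = y (x - x') + x' (y - y')]. *)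
  destruct (linear_system_zero
    (fun s => a1 + a3 * (x s + x' s) + a5 * y s)
    (fun s => a2 + a4 * (y s + y' s) + a5 * x' s)
    (fun s => b1 + b3 * (x s + x' s) + b5 * y s)
    (fun s => b2 + b4 * (y s + y' s) + b5 * x' s)
    (fun s => x s - x' s) (fun s => y s - y' s) t) as [Hx Hy]; try lra.
  - intros s Hs; destruct (HD s Hs) as [[Hx Hy] [Hx' Hy']].
    assert (ex_derive x s) by (eexists; exact Hx).
    assert (ex_derive y s) by (eexists; exact Hy).
    assert (ex_derive x' s) by (eexists; exact Hx').
    assert (ex_derive y' s) by (eexists; exact Hy').
    repeat split; apply (ex_derive_continuous (V := R_NormedModule)); auto_derive; repeat split; assumption.
  - intros s Hs; destruct (HD s Hs) as [[Hx Hy] [Hx' Hy']].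
    split.
    + evar_last; [exact (is_derive_minus x x' s _ _ Hx Hx') |].
      unfold minus, plus, opp; simpl; ring.
    + evar_last; [exact (is_derive_minus y y' s _ _ Hy Hy') |].
      unfold minus, plus, opp; simpl; ring.
Qed.

(** * Invariance of a line from a cofactor *)

Lemma affine_function_invariant (a1 a2 a3 a4 a5 b1 b2 b3 b4 b5 : R)
    (p q r A B C : R) :
  (* The line [p x + q y + r = 0] is an algebraic invariant curve of cofactor [A x + B y + C]. *)
  (forall x y,
     p * (a1 * x + a2 * y + a3 * x ^ 2 + a4 * y ^ 2 + a5 * x * y)
     + q * (b1 * x + b2 * y + b3 * x ^ 2 + b4 * y ^ 2 + b5 * x * y)
     = (A * x + B * y + C) * (p * x + q * y + r)) ->
  invariant (quadratic_field a1 a2 a3 a4 a5 b1 b2 b3 b4 b5)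
    (fun z => p * fst z + q * snd z + r = 0).
Proof.
  intros Hcof X0 HX0 t Ht.
  apply flow_reaches in Ht; unfold In in *.
  set (z := flow _ t X0) in *; clearbody z.
  destruct Ht as [al [be [phi [[H0 [Hi Hphi]] [Ht Hz]]]]].
  unfold quadratic_field in Hphi.
  pose (x := fun s => fst (phi s)); pose (y := fun s => snd (phi s)).
  assert (HD : forall s, Rmin 0 t <= s <= Rmax 0 t ->
    is_derive x s (a1 * x s + a2 * y s + a3 * x s ^ 2 + a4 * y s ^ 2 + a5 * x s * y s) /\
    is_derive y s (b1 * x s + b2 * y s + b3 * x s ^ 2 + b4 * y s ^ 2 + b5 * x s * y s)).
  { intros s Hs.
    specialize (Hphi s (in_interval_segment _ _ _ _ H0 Ht Hs)).
    unfold x, y; destruct (phi s); exact Hphi. }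
  rewrite <- Hz; change (p * x t + q * y t + r = 0).
  assert (Hw0 : p * x 0 + q * y 0 + r = 0) by (unfold x, y; now rewrite Hi).
  clear Hphi Hz; clearbody x y.
  (* The scalar equation [w' = (A x + B y + C) w] is treated as a linear system whose second unknown
     is identically 0. *)
  refine (proj1 (linear_system_zero
    (fun s => A * x s + B * y s + C) (fun _ => 0) (fun _ => 0) (fun _ => 0)
    (fun s => p * x s + q * y s + r) (fun _ => 0) t _ _ Hw0 eq_refl)).
  - intros s Hs; destruct (HD s Hs) as [Hx Hy].
    assert (ex_derive x s) by (eexists; exact Hx).
    assert (ex_derive y s) by (eexists; exact Hy).
    repeat split; try apply continuous_const.
    apply (ex_derive_continuous (V := R_NormedModule)); auto_derive; repeat split; assumption.
  - intros s Hs; destruct (HD s Hs) as [Hx Hy]; split.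
    + auto_derive;
        [split; [eexists; exact Hx | split; [eexists; exact Hy | easy]] |].
      replace (Derive (fun x0 => x x0) s) with
        (a1 * x s + a2 * y s + a3 * x s ^ 2 + a4 * y s ^ 2 + a5 * x s * y s)
        by (symmetry; now apply is_derive_unique).
      replace (Derive (fun x0 => y x0) s) with
        (b1 * x s + b2 * y s + b3 * x s ^ 2 + b4 * y s ^ 2 + b5 * x s * y s)
        by (symmetry; now apply is_derive_unique).
      rewrite <- Hcof; ring.
    + evar_last; [apply is_derive_const |]. unfold zero; simpl; ring.
Qed.

(** * Local existence by power series *)

(** Cauchy products make each Taylor coefficient of a solution depend on all earlier ones, so
    recursion on the last value alone is not enough. *)
Lemma course_of_values_recursion {T : Type} (F : nat -> (nat -> T) -> T) (c : T) :
  (forall n f g, (forall k, (k <= n)%nat -> f k = g k) -> F n f = F n g) ->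
  exists s, s 0%nat = c /\ forall n, s (S n) = F n s.
Proof.
  intros HF.
  (* [pre n] is a table of the sequence, correct up to index [n] and repeating its last value
     beyond. The hypothesis on [F] makes that tail harmless. *)
  pose (pre := fix pre n : nat -> T :=
    match n with
    | O => fun _ => c
    | S n => fun k => if Nat.leb k n then pre n k else F n (pre n)
    end).
  assert (HpreS : forall n, pre (S n) (S n) = F n (pre n)).
  { intros n; change (pre (S n) (S n)) with
      (if Nat.leb (S n) n then pre n (S n) else F n (pre n)).
    destruct (Nat.leb_spec (S n) n); [lia | reflexivity]. }
  assert (Hpre : forall n k, (k <= n)%nat -> pre n k = pre k k).
  { induction n as [| n IH]; intros k Hk.
    - now replace k with 0%nat by lia.
    - destruct (Nat.eq_dec k (S n)) as [-> | Hne]; [reflexivity |].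
      rewrite <- IH by lia.
      change (pre (S n) k) with (if Nat.leb k n then pre n k else F n (pre n)).
      destruct (Nat.leb_spec k n); [reflexivity | lia]. }
  exists (fun n => pre n n); split; [reflexivity |].
  intros n; rewrite HpreS.
  apply HF; intros k Hk; now apply Hpre.
Qed.

Lemma PS_mult_ext_le (f f' g g' : nat -> R) (n : nat) :
  (forall k, (k <= n)%nat -> f k = f' k /\ g k = g' k) ->
  PS_mult f g n = PS_mult f' g' n.
Proof.
  intros H; apply sum_eq; intros k Hk.
  rewrite (proj1 (H k Hk)), (proj2 (H (n - k)%nat ltac:(lia))); reflexivity.
Qed.

(** Each of the [n + 1] terms of the Cauchy product is at most [M ^ 2 * K ^ n]. The factor
    [INR (S n)] will cancel against the division by [n + 1] that integrates the series. *)
Lemma PS_mult_geometric_bound (f g : nat -> R) (M K : R) (n : nat) :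
  (forall k, (k <= n)%nat -> Rabs (f k) <= M * K ^ k /\ Rabs (g k) <= M * K ^ k) ->
  Rabs (PS_mult f g n) <= INR (S n) * (M ^ 2 * K ^ n).
Proof.
  intros H.
  eapply Rle_trans; [apply Rsum_abs |].
  rewrite Rmult_comm, <- sum_cte.
  apply sum_Rle; intros k Hk.
  rewrite Rabs_mult.
  replace (M ^ 2 * K ^ n) with ((M * K ^ k) * (M * K ^ (n - k))).
  - apply Rmult_le_compat; try apply Rabs_pos; apply H; lia.
  - replace n with (k + (n - k))%nat at 2 by lia. rewrite pow_add; ring.
Qed.

(** The Taylor coefficient of order [n] of one component of the field along the curve whose
    coordinates have coefficients [f] and [g]. *)
Definition quadratic_coef (c1 c2 c3 c4 c5 : R) (f g : nat -> R) (n : nat) : R :=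
  c1 * f n + c2 * g n + c3 * PS_mult f f n + c4 * PS_mult g g n + c5 * PS_mult f g n.

Lemma quadratic_coef_ext_le (c1 c2 c3 c4 c5 : R) (f f' g g' : nat -> R) (n : nat) :
  (forall k, (k <= n)%nat -> f k = f' k /\ g k = g' k) ->
  quadratic_coef c1 c2 c3 c4 c5 f g n = quadratic_coef c1 c2 c3 c4 c5 f' g' n.
Proof.
  intros H; unfold quadratic_coef.
  rewrite (PS_mult_ext_le f f' f f'), (PS_mult_ext_le g g' g g'),
    (PS_mult_ext_le f f' g g') by (intros k Hk; destruct (H k Hk); auto).
  destruct (H n (le_n n)) as [-> ->]; reflexivity.
Qed.

Lemma quadratic_coef_bound (c1 c2 c3 c4 c5 A M K : R) (f g : nat -> R) (n : nat) :
  Rabs c1 + Rabs c2 + Rabs c3 + Rabs c4 + Rabs c5 <= A -> 0 <= M -> 0 <= K ->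
  (forall k, (k <= n)%nat -> Rabs (f k) <= M * K ^ k /\ Rabs (g k) <= M * K ^ k) ->
  Rabs (quadratic_coef c1 c2 c3 c4 c5 f g n)
    <= INR (S n) * (A * (1 + M) * (M * K ^ n)).
Proof.
  intros HA HM HK H.
  destruct (H n (le_n n)) as [Hf Hg].
  assert (Hff : Rabs (PS_mult f f n) <= INR (S n) * (M ^ 2 * K ^ n))
    by (apply PS_mult_geometric_bound; intros k Hk; now split; apply H).
  assert (Hgg : Rabs (PS_mult g g n) <= INR (S n) * (M ^ 2 * K ^ n))
    by (apply PS_mult_geometric_bound; intros k Hk; now split; apply H).
  assert (Hfg : Rabs (PS_mult f g n) <= INR (S n) * (M ^ 2 * K ^ n))
    by (now apply PS_mult_geometric_bound).
  assert (HKn : 0 <= K ^ n) by now apply pow_le.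
  assert (Hn : 1 <= INR (S n)) by (rewrite S_INR; pose proof (pos_INR n); lra).
  set (N := INR (S n)) in *.
  set (P := M * K ^ n) in *.
  assert (HP : 0 <= P) by (apply Rmult_le_pos; assumption).
  (* [U] dominates the linear terms, of size [P], as well as the Cauchy products, so the five
     coefficients can be factored out together. *)
  set (U := N * ((1 + M) * P)).
  assert (HU1 : P <= U) by (unfold U; assert (0 <= M * P) by nra; nra).
  assert (HU2 : N * (M ^ 2 * K ^ n) <= U)
    by (unfold U; apply Rmult_le_compat_l; [lra |]; unfold P in *; nra).
  assert (Hterm : forall c z, Rabs z <= U -> Rabs (c * z) <= Rabs c * U).
  { intros c z Hz; rewrite Rabs_mult.
    apply Rmult_le_compat_l; [apply Rabs_pos | exact Hz]. }
  unfold quadratic_coef.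
  pose proof (Hterm c1 (f n) ltac:(lra)).
  pose proof (Hterm c2 (g n) ltac:(lra)).
  pose proof (Hterm c3 (PS_mult f f n) ltac:(lra)).
  pose proof (Hterm c4 (PS_mult g g n) ltac:(lra)).
  pose proof (Hterm c5 (PS_mult f g n) ltac:(lra)).
  replace (N * (A * (1 + M) * P)) with (A * U) by (unfold U; ring).
  apply Rle_trans with
    ((Rabs c1 + Rabs c2 + Rabs c3 + Rabs c4 + Rabs c5) * U).
  - do 4 (eapply Rle_trans; [apply Rabs_triang |]; rewrite ?Rmult_plus_distr_r;
          apply Rplus_le_compat; [| assumption]).
    assumption.
  - apply Rmult_le_compat_r; [lra | exact HA].
Qed.

(** Inside both radii of convergence, Cauchy products of the series sum to products of their
    sums. *)
Lemma quadratic_coef_PSeries (c1 c2 c3 c4 c5 : R) (f g : nat -> R) (t : R) :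
  Rbar_lt (Rabs t) (CV_radius f) -> Rbar_lt (Rabs t) (CV_radius g) ->
  let x := PSeries f t in
  let y := PSeries g t in
  PSeries (quadratic_coef c1 c2 c3 c4 c5 f g) t
    = c1 * x + c2 * y + c3 * x ^ 2 + c4 * y ^ 2 + c5 * x * y.
Proof.
  intros Hf Hg x y.
  assert (Hx : is_pseries f t x) by apply PSeries_correct, CV_radius_inside, Hf.
  assert (Hy : is_pseries g t y) by apply PSeries_correct, CV_radius_inside, Hg.
  pose proof (is_pseries_mult f f t x x Hx Hx Hf Hf) as Hxx.
  pose proof (is_pseries_mult g g t y y Hy Hy Hg Hg) as Hyy.
  pose proof (is_pseries_mult f g t x y Hx Hy Hf Hg) as Hxy.
  assert (Hscal : forall (c : R) (h : nat -> R) (z : R),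
    is_pseries h t z -> is_pseries (PS_scal c h) t (scal c z))
    by (intros c h z Hz; exact (is_pseries_scal c h t z (Rmult_comm t c) Hz)).
  replace (c1 * x + c2 * y + c3 * x ^ 2 + c4 * y ^ 2 + c5 * x * y)
    with (c1 * x + c2 * y + c3 * (x * x) + c4 * (y * y) + c5 * (x * y)) by ring.
  apply is_pseries_unique.
  exact (is_pseries_plus _ _ _ _ _
    (is_pseries_plus _ _ _ _ _
      (is_pseries_plus _ _ _ _ _
        (is_pseries_plus _ _ _ _ _ (Hscal c1 _ _ Hx) (Hscal c2 _ _ Hy))
        (Hscal c3 _ _ Hxx))
      (Hscal c4 _ _ Hyy))
    (Hscal c5 _ _ Hxy)).
Qed.

Lemma CV_radius_of_geometric_bound (f : nat -> R) (M K t : R) :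
  0 < K -> (forall n, Rabs (f n) <= M * K ^ n) -> Rabs t < / K ->
  Rbar_lt (Rabs t) (CV_radius f).
Proof.
  intros HK Hf Ht.
  apply Rbar_lt_le_trans with (/ K); [exact Ht |].
  apply (proj1 (CV_radius_bounded f)).
  exists M; intros n.
  assert (HKn : 0 < K ^ n) by now apply pow_lt.
  rewrite pow_inv, Rabs_mult, (Rabs_pos_eq (/ K ^ n))
    by now apply Rlt_le, Rinv_0_lt_compat.
  apply Rmult_le_reg_r with (K ^ n); [exact HKn |].
  rewrite Rmult_assoc, Rinv_l, Rmult_1_r by lra.
  apply Hf.
Qed.

(** Comparing coefficients of [t ^ n] in the system determines a formal solution. A geometric bound
    [M * K ^ n] on its coefficients gives convergence for [|t| < / K], and termwise differentiation
    shows that the sum solves the system. *)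
Lemma quadratic_local_solution (a1 a2 a3 a4 a5 b1 b2 b3 b4 b5 : R) (X0 : R * R) :
  exists (e : R) (phi : R -> R * R),
    0 < e /\
    is_solution (quadratic_field a1 a2 a3 a4 a5 b1 b2 b3 b4 b5) X0 (- e) e phi.
Proof.
  destruct (course_of_values_recursion
    (fun n s =>
       let f k := fst (s k) in
       let g k := snd (s k) in
       (quadratic_coef a1 a2 a3 a4 a5 f g n / INR (S n),
        quadratic_coef b1 b2 b3 b4 b5 f g n / INR (S n))) X0)
    as [s [Hs0 HsS]].
  { intros n s s' Hss; cbv zeta.
    f_equal; f_equal; apply quadratic_coef_ext_le;
      intros k Hk; now rewrite Hss. }
  cbv zeta in HsS.
  pose (f := fun k => fst (s k)); pose (g := fun k => snd (s k)).
  assert (HfS : forall n, f (S n) = quadratic_coef a1 a2 a3 a4 a5 f g n / INR (S n))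
    by (intros n; unfold f at 1; now rewrite HsS).
  assert (HgS : forall n, g (S n) = quadratic_coef b1 b2 b3 b4 b5 f g n / INR (S n))
    by (intros n; unfold g at 1; now rewrite HsS).
  assert (HX0 : (f 0%nat, g 0%nat) = X0)
    by (unfold f, g; rewrite Hs0; now destruct X0).
  clearbody f g; clear s Hs0 HsS.
  set (M := Rabs (f 0%nat) + Rabs (g 0%nat)).
  set (SA := Rabs a1 + Rabs a2 + Rabs a3 + Rabs a4 + Rabs a5).
  set (SB := Rabs b1 + Rabs b2 + Rabs b3 + Rabs b4 + Rabs b5).
  assert (HM : Rabs (f 0%nat) <= M /\ Rabs (g 0%nat) <= M /\ 0 <= M)
    by (unfold M; pose proof (Rabs_pos (f 0%nat)); pose proof (Rabs_pos (g 0%nat)); lra).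
  assert (HSA : 0 <= SA) by (unfold SA; repeat apply Rplus_le_le_0_compat; apply Rabs_pos).
  assert (HSB : 0 <= SB) by (unfold SB; repeat apply Rplus_le_le_0_compat; apply Rabs_pos).
  clearbody M.
  (* [K] is chosen so that the bound reproduces itself: one step of the recursion costs a factor
     [A * (1 + M)]. The summand 1 keeps [K] positive even for the zero field. *)
  set (A := SA + SB + 1).
  set (K := A * (1 + M)).
  assert (HK : 0 < K) by (unfold K, A; apply Rmult_lt_0_compat; lra).
  assert (Hdiv : forall z n, Rabs z <= INR (S n) * (K * (M * K ^ n)) ->
    Rabs (z / INR (S n)) <= M * K ^ S n).
  { intros z n Hz.
    assert (Hn : 0 < INR (S n)) by apply lt_0_INR, Nat.lt_0_succ.
    rewrite Rabs_div, (Rabs_pos_eq (INR (S n))) by lra.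
    apply Rmult_le_reg_r with (INR (S n)); [exact Hn |].
    replace (Rabs z / INR (S n) * INR (S n)) with (Rabs z) by (field; lra).
    eapply Rle_trans; [exact Hz |]. apply Req_le; simpl; ring. }
  (* The induction carries all indices up to [n], because the next coefficient involves every
     earlier one. *)
  assert (Hbound : forall n k, (k <= n)%nat ->
    Rabs (f k) <= M * K ^ k /\ Rabs (g k) <= M * K ^ k).
  { induction n as [| n IH]; intros k Hk.
    - replace k with 0%nat by lia; simpl; lra.
    - destruct (Nat.eq_dec k (S n)) as [-> | Hne]; [| apply IH; lia].
      rewrite HfS, HgS; split; apply Hdiv; unfold K at 1;
        apply quadratic_coef_bound; try tauto; try lra; fold SA SB; unfold A; lra. }
  assert (Hrf : forall t, Rabs t < / K -> Rbar_lt (Rabs t) (CV_radius f))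
    by (intros t; apply (CV_radius_of_geometric_bound f M K t HK);
        intros n; now apply (Hbound n n)).
  assert (Hrg : forall t, Rabs t < / K -> Rbar_lt (Rabs t) (CV_radius g))
    by (intros t; apply (CV_radius_of_geometric_bound g M K t HK);
        intros n; now apply (Hbound n n)).
  assert (He : 0 < / K) by now apply Rinv_0_lt_compat.
  exists (/ K), (fun t => (PSeries f t, PSeries g t)).
  split; [exact He | split; [| split]].
  - split; simpl; lra.
  - now rewrite !PSeries_0.
  - intros t [Ht1 Ht2]; simpl in Ht1, Ht2.
    assert (Ht : Rabs t < / K) by now apply Rabs_def1.
    assert (Hder : forall (h : nat -> R) c1 c2 c3 c4 c5,
      Rbar_lt (Rabs t) (CV_radius h) ->
      (forall n, h (S n) = quadratic_coef c1 c2 c3 c4 c5 f g n / INR (S n)) ->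
      is_derive (PSeries h) t
        (c1 * PSeries f t + c2 * PSeries g t + c3 * PSeries f t ^ 2
         + c4 * PSeries g t ^ 2 + c5 * PSeries f t * PSeries g t)).
    { intros h c1 c2 c3 c4 c5 Hrh HhS.
      rewrite <- (quadratic_coef_PSeries c1 c2 c3 c4 c5 f g t (Hrf t Ht) (Hrg t Ht)).
      (* The recursion says exactly that the differentiated series has the coefficients of the
         right-hand side. *)
      rewrite (PSeries_ext _ (PS_derive h)).
      - now apply is_derive_PSeries.
      - intros n; unfold PS_derive; rewrite HhS.
        field; now apply not_0_INR. }
    split; apply Hder; auto.
Qed.

(** * The criterion for lines through the origin *)

Lemma invariant_line_tangent (a1 a2 a3 a4 a5 b1 b2 b3 b4 b5 m : R) (X0 : R * R) :
  let V := quadratic_field a1 a2 a3 a4 a5 b1 b2 b3 b4 b5 in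
  invariant V (line_through_origin m) -> line_through_origin m X0 ->
  snd (V X0) = m * fst (V X0).
Proof.
  intros V Hinv HX0.
  destruct (quadratic_local_solution a1 a2 a3 a4 a5 b1 b2 b3 b4 b5 X0)
    as [e [phi [He Hsol]]].
  fold V in Hsol; pose proof Hsol as [H0 [Hi Hder]].
  assert (Hline : forall t, in_interval (- e) e t -> snd (phi t) = m * fst (phi t)).
  { intros t Ht.
    assert (Hr : reaches V X0 t (phi t)) by (exists (- e), e, phi; auto).
    assert (Hmax : In _ (maximal_interval V X0) t) by (exists (phi t); exact Hr).
    (* Invariance speaks of the value selected by [flow]; uniqueness identifies it with [phi t]. *)
    rewrite (quadratic_reaches_unique _ _ _ _ _ _ _ _ _ _ _ _ _ _ Hr
      (flow_reaches V X0 t Hmax)).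
    exact (Hinv X0 HX0 t Hmax). }
  destruct (Hder 0 H0) as [Hx Hy]; rewrite Hi in Hx, Hy.
  rewrite <- (is_derive_unique _ _ _ Hy).
  apply is_derive_unique.
  (* The two coordinates are proportional only on [(-e, e)], which suffices for the derivatives at
     0. *)
  apply is_derive_ext_loc with (fun s => m * fst (phi s)).
  - exists (mkposreal e He); intros t Ht; symmetry; apply Hline.
    unfold ball in Ht; simpl in Ht; unfold AbsRing_ball, abs, minus, plus, opp in Ht;
      simpl in Ht.
    apply Rabs_def2 in Ht; split; simpl; lra.
  - exact (is_derive_scal _ _ m _ Hx).
Qed.

Lemma invariant_ext (V : R * R -> R * R) (S T : Ensemble (R * R)) :
  (forall p, S p <-> T p) -> invariant V S -> invariant V T.
Proof.
  intros H HS X0 HX0 t Ht; apply H, HS; [now apply H | exact Ht].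
Qed.

Lemma invariant_line_iff (a1 a2 a3 a4 a5 b1 b2 b3 b4 b5 m : R) :
  invariant (quadratic_field a1 a2 a3 a4 a5 b1 b2 b3 b4 b5) (line_through_origin m) <->
  a2 * m ^ 2 + (a1 - b2) * m - b1 = 0 /\
  a4 * m ^ 3 + (a5 - b4) * m ^ 2 + (a3 - b5) * m - b3 = 0.
Proof.
  split.
  - intros Hinv.
    (* Tangency at these two points reads [Q(m) + C(m) = 0] and [- Q(m) + C(m) = 0]. *)
    pose proof (invariant_line_tangent _ _ _ _ _ _ _ _ _ _ m (1, m * 1) Hinv eq_refl) as H1.
    pose proof (invariant_line_tangent _ _ _ _ _ _ _ _ _ _ m (-1, m * -1) Hinv eq_refl) as H2.
    simpl in H1, H2; split; lra.
  - intros [HQ HC].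
    apply invariant_ext with (fun z => - m * fst z + 1 * snd z + 0 = 0).
    { intros p; unfold line_through_origin; split; lra. }
    (* The coefficients of [y ^ 2], [x y] and [y] in [y' - m x'] determine the cofactor. Those of
       [x] and [x ^ 2] then match exactly when [Q(m) = 0] and [C(m) = 0]. *)
    apply affine_function_invariant with
      (A := b5 - m * a5 + m * (b4 - m * a4)) (B := b4 - m * a4) (C := b2 - m * a2).
    intros x y.
    replace b1 with (a2 * m ^ 2 + (a1 - b2) * m) by lra.
    replace b3 with (a4 * m ^ 3 + (a5 - b4) * m ^ 2 + (a3 - b5) * m) by lra.
    ring.
Qed.

(** * Infinitely many lines and vanishing of coefficients *)

Lemma Finite_incl_list {U : Type} (A : Ensemble U) :
  Finite_sets.Finite U A -> exists l, forall x, In U A x -> List.In x l.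
Proof.
  induction 1 as [| A _ [l Hl] x _].
  - exists nil; intros x [].
  - exists (x :: l); intros y [z Hz | z Hz]; [right; now apply Hl |].
    left; now destruct Hz.
Qed.

(** Pigeonhole: a list covering the set would contain more distinct values of [f] than its
    length. *)
Lemma not_Finite_of_injective_sequence {U : Type} (A : Ensemble U) (f : nat -> U) :
  (forall i j, f i = f j -> i = j) -> (forall i, In U A (f i)) ->
  ~ Finite_sets.Finite U A.
Proof.
  intros Hinj HA Hfin.
  destruct (Finite_incl_list A Hfin) as [l Hl].
  assert (H : (length (map f (seq 0 (S (length l)))) <= length l)%nat).
  { apply NoDup_incl_length.
    - apply Injective_map_NoDup; [exact Hinj | apply seq_NoDup].
    - intros y Hy; apply in_map_iff in Hy; destruct Hy as [i [<- _]].
      apply Hl, HA. }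
  rewrite length_map, length_seq in H; lia.
Qed.

Lemma line_through_origin_inj (m m' : R) :
  line_through_origin m = line_through_origin m' -> m = m'.
Proof.
  intros H.
  assert (Hp : line_through_origin m (1, m)) by (unfold line_through_origin; simpl; ring).
  rewrite H in Hp; unfold line_through_origin in Hp; simpl in Hp; lra.
Qed.

Lemma quadratic_zero_coefs (c0 c1 c2 : R) :
  (forall z, c0 + c1 * z + c2 * z ^ 2 = 0) -> c0 = 0 /\ c1 = 0 /\ c2 = 0.
Proof.
  intros H; pose proof (H 0); pose proof (H 1); pose proof (H (-1)); lra.
Qed.

(** * The case distinction and the lines parallel to the axes *)

Theorem theorem3p3 (a1 a2 a3 a4 a5 b1 b2 b3 b4 b5 : R) :
  let V := quadratic_field a1 a2 a3 a4 a5 b1 b2 b3 b4 b5 in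
  let Q (m : R) := a2 * m ^ 2 + (a1 - b2) * m - b1 = 0 in
  let C (m : R) := a4 * m ^ 3 + (a5 - b4) * m ^ 2 + (a3 - b5) * m - b3 = 0 in
  let case_a := a2 = 0 /\ b1 = 0 /\ a1 = b2 in
  let case_b := a4 = 0 /\ b3 = 0 /\ a5 = b4 /\ a3 = b5 /\
                (b2 - a1) ^ 2 + 4 * b1 * a2 >= 0 in
  let all_zero := (a2 = 0 /\ a1 - b2 = 0 /\ - b1 = 0) /\
                  (a4 = 0 /\ a5 - b4 = 0 /\ a3 - b5 = 0 /\ - b3 = 0) in
  ((forall m : R,
      invariant V (line_through_origin m) <->
        (case_a /\ C m)
        \/ (case_b /\ b1 + (b2 - a1) * m - a2 * m ^ 2 = 0)
        \/ (~ all_zero /\ Q m /\ C m)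
        \/ all_zero)
   /\ (case_a -> forall m : R, invariant V (line_through_origin m) <-> C m)
   /\ (case_b -> forall m : R,
         invariant V (line_through_origin m) <->
         b1 + (b2 - a1) * m - a2 * m ^ 2 = 0)
   /\ (~ all_zero -> forall m : R,
         invariant V (line_through_origin m) <-> Q m /\ C m)
   /\ (all_zero ->
         (forall m : R, invariant V (line_through_origin m)) /\
         ~ Finite_sets.Finite (Ensemble (R * R))
             (fun L => (exists m : R, L = line_through_origin m) /\ invariant V L)))
  /\ (forall k : R,
        (forall y : R, a1 * k + a2 * y + a3 * k ^ 2 + a4 * y ^ 2 + a5 * k * y = 0) ->
        invariant V (vertical_line k))
  /\ (forall l : R,
        (forall x : R, b1 * x + b2 * l + b3 * x ^ 2 + b4 * l ^ 2 + b5 * x * l = 0) ->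
        invariant V (horizontal_line l)).

Proof.
  intros V Q C case_a case_b all_zero.
  (* Every case of the first part reduces to this equivalence: (a) turns [Q] into an identity, (b)
     does so for [C], and (d) for both. *)
  assert (Hiff : forall m, invariant V (line_through_origin m) <-> Q m /\ C m)
    by (intros m; apply invariant_line_iff).
  assert (Ha : case_a -> forall m, Q m).
  { intros [-> [-> ->]] m; unfold Q; ring. }
  assert (Hb : case_b -> forall m, C m).
  { intros [-> [-> [-> [-> _]]]] m; unfold C; ring. }
  assert (HbQ : forall m, b1 + (b2 - a1) * m - a2 * m ^ 2 = 0 <-> Q m)
    by (intros m; unfold Q; split; intros; lra).
  assert (Hz : all_zero -> forall m, Q m /\ C m).
  { intros [[H1 [H2 H3]] [H4 [H5 [H6 H7]]]] m; unfold Q, C.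
    rewrite H1, H2, H4, H5, H6; split; lra. }
  split; [| split].
  - split; [| split; [| split; [| split]]].
    + intros m; rewrite Hiff; split.
      (* An invariant line falls under (d) if all coefficients vanish and under (c) otherwise. *)
      * destruct (classic all_zero); tauto.
      * intros [[Ha' HC] | [[Hb' HQ] | [[_ HQC] | Hz']]]; auto.
        split; [now apply HbQ | now apply Hb].
    + intros Ha' m; rewrite Hiff; split; [tauto | auto].
    + intros Hb' m; rewrite Hiff, HbQ; split; [tauto | auto].
    + intros _; exact Hiff.
    + intros Hz'; split; [intros m; apply Hiff; auto |].
      apply not_Finite_of_injective_sequence with
        (fun n => line_through_origin (INR n)).
      * intros i j H; now apply INR_eq, line_through_origin_inj.
      * intros i; split; [now exists (INR i) | apply Hiff; auto].
  - intros k Hk.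
    destruct (quadratic_zero_coefs (a1 * k + a3 * k ^ 2) (a2 + a5 * k) a4)
      as [H0 [H1 H2]]; [intros y; rewrite <- (Hk y); ring |].
    apply invariant_ext with (fun z => 1 * fst z + 0 * snd z + - k = 0).
    { intros p; unfold vertical_line; split; lra. }
    (* With [a4 = 0] and [a2 = - a5 * k], dividing [x'] by [x - k] gives this cofactor and the
       remainder [a1 * k + a3 * k ^ 2], which is 0 by [H0]. *)
    apply affine_function_invariant with (A := a3) (B := a5) (C := a1 + a3 * k).
    intros x y; rewrite H2.
    replace a2 with (- a5 * k) by lra.
    transitivity ((a3 * x + a5 * y + (a1 + a3 * k)) * (1 * x + 0 * y + - k)
                  + (a1 * k + a3 * k ^ 2)); [ring |].
    rewrite H0; ring.
  - intros l Hl.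
    destruct (quadratic_zero_coefs (b2 * l + b4 * l ^ 2) (b1 + b5 * l) b3)
      as [H0 [H1 H2]]; [intros x; rewrite <- (Hl x); ring |].
    apply invariant_ext with (fun z => 0 * fst z + 1 * snd z + - l = 0).
    { intros p; unfold horizontal_line; split; lra. }
    (* The same division, now of [y'] by [y - l], with remainder [b2 * l + b4 * l ^ 2]. *)
    apply affine_function_invariant with (A := b5) (B := b4) (C := b2 + b4 * l).
    intros x y; rewrite H2.
    replace b1 with (- b5 * l) by lra.
    transitivity ((b5 * x + b4 * y + (b2 + b4 * l)) * (0 * x + 1 * y + - l)
                  + (b2 * l + b4 * l ^ 2)); [ring |].
    rewrite H0; ring.
Qed.
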